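(* Let $\beta\geq 2$. In the CONGEST model, any $\beta$-ruling edge set of a graph $G$ can be transformed into a $2$-ruling edge set of $G$ in $O(\beta)$ rounds of communication.
   Context: CONGEST model: the network is an $n$-node graph $G=(V,E)$; each node has a unique $O(\log n)$-bit ID; computation proceeds in synchronous rounds, in each of which every node may send a message of $O(\log n)$ bits to each neighbor and perform unbounded local computation. The input ruling edge set is given distributedly (each node knows which of its incident edges belong to it), and so is the output. The distance $\mathrm{dist}(e,f)$ between two edges is the distance between the corresponding nodes in the line graph of $G$. An $(\alpha,\beta)$-ruling edge set of $G$ is a set $R\subseteq E$ such that any two distinct edges of $R$ are at distance at least $\alpha$ and every edge $e\in E$ has some $f\in R$ with $\mathrm{dist}(e,f)\leq\beta$; a $\beta$-ruling edge set is a $(2,\beta)$-ruling edge set. *)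

(* Defs.v *)
From mathcomp Require Import all_boot.

Set Implicit Arguments.
Unset Strict Implicit.
Unset Printing Implicit Defensive.

Record sgraph := SGraph {
  node :> finType;
  adj : rel node;
  adj_sym : symmetric adj;
  adj_irr : irreflexive adj
}.

Definition edges (G : sgraph) : {set {set G}} :=
  [set [set x.1; x.2] | x : G * G & adj x.1 x.2].

(* The line graph is taken on the whole type {set G}; sets that are not edges
   are isolated in it. *)
Definition line_adj (G : sgraph) : rel {set G} :=
  fun e f => [&& e \in edges G, f \in edges G, e != f & e :&: f != set0].

(* The distance from x to y in the graph r is d; no d qualifies when x and y
   are not connected, i.e. when their distance is infinite. *)
Definition is_dist (T : eqType) (r : rel T) (x y : T) (d : nat) : Prop :=
  (exists p, [/\ path r x p, last x p = y & size p = d]) /\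
  (forall p, path r x p -> last x p = y -> d <= size p).

Definition ruling_edge_set (G : sgraph) (alpha beta : nat)
    (R : {set {set G}}) : Prop :=
  [/\ R \subset edges G,
      forall e f d, e \in R -> f \in R -> e != f ->
        is_dist (@line_adj G) e f d -> alpha <= d
    & forall e, e \in edges G ->
        exists2 f, f \in R & exists2 d, is_dist (@line_adj G) e f d & d <= beta].

(* A node addresses its incident edges by port numbers 0, 1, ...: port i of v
   leads to the i-th element of [nbrs v]. The order is arbitrary, and the node
   is not told which node lies behind a port. *)
Record network := Network {
  graph :> sgraph;
  nbrs : graph -> seq graph;
  nbrs_uniq : forall v, uniq (nbrs v);
  mem_nbrs : forall v u, (u \in nbrs v) = adj v u;
  ident : graph -> bitseq;
  ident_inj : injective ident
}.

(* The number of binary digits of n: of order log n for n > 1, and nonzero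
   for n = 1. *)
Definition log_size (n : nat) : nat := (trunc_log 2 n).+1.

Definition ids_within (k : nat) (N : network) : Prop :=
  forall v : N, size (ident v) <= k * log_size #|N|.

(* The same deterministic program runs at every node. It starts from the
   identifier of the node and, port by port, whether the incident edge belongs
   to the input edge set; the length of that list is the degree. No bound is
   put on local computation: the components are arbitrary functions. *)
Record algorithm := Algorithm {
  state : Type;
  init : bitseq -> bitseq -> state;
  (* message sent through a given port, None for silence *)
  send : state -> nat -> option bitseq;
  (* new state from the messages received, listed by port *)
  recv : state -> seq (option bitseq) -> state;
  (* whether the edge at a given port belongs to the output edge set *)
  out : state -> nat -> bool
}.

Section Execution.
Variables (A : algorithm) (N : network) (R : {set {set N}}).

Definition message (s : N -> state A) (u v : N) : option bitseq :=
  send (s u) (index v (nbrs u)).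

Fixpoint run (t : nat) : N -> state A :=
  if t is t'.+1 then
    fun v => recv (run t' v) [seq message (run t') u v | u <- nbrs v]
  else fun v => init A (ident v) [seq [set v; u] \in R | u <- nbrs v].

Definition messages_within (c T : nat) : Prop :=
  forall t (u v : N) m, t < T -> adj u v ->
    message (run t) u v = Some m -> size m <= c * log_size #|N|.

(* In particular the two endpoints of an edge agree on it. *)
Definition outputs_after (T : nat) (S : {set {set N}}) : Prop :=
  S \subset edges N /\
  forall v u : N, adj v u ->
    out (run T v) (index u (nbrs v)) = ([set v; u] \in S).

End Execution.

Definition congest_transforms (A : algorithm) (T c : nat) (N : network)
    (R : {set {set N}}) (P : {set {set N}} -> Prop) : Prop :=
  messages_within A R c T /\ exists2 S, outputs_after A R T S & P S.

(* Main.v *)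
Require Import Defs.
From mathcomp Require Import all_boot zify.

Set Implicit Arguments.
Unset Strict Implicit.
Unset Printing Implicit Defensive.

(** Layer the nodes by their distance to the endpoints of R, at most beta, and
let every node outside layer 0 choose a parent one layer below; the parent of a
node of layer 0 is its partner in R. Going from layer beta down to layer 1, the
unmatched nodes of the layer propose to their parents, and every parent that
gets a proposal accepts one. Finally each edge of R with two unmatched
endpoints is kept. An unmatched node has lost to a sibling or has a matched
partner in R, so its parent is matched; hence every node is matched or adjacent
to a matched node, and the matching is 2-ruling. All messages are empty: only
their presence carries information. *)

(** * Unordered pairs, and positions in sequences *)

Lemma set2_eq (T : finType) (a b c d : T) :
  [set a; b] = [set c; d] -> (a = c /\ b = d) \/ (a = d /\ b = c).
Proof.
move=> E.
have := set21 a b; rewrite E !inE; case/orP=> /eqP Ea.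
  have := set22 a b; rewrite E !inE; case/orP=> /eqP Eb; last by left.
  by have := set22 c d; rewrite -E !inE Ea Eb => /orP[] /eqP->; left.
have := set22 a b; rewrite E !inE; case/orP=> /eqP Eb; first by right.
by have := set21 c d; rewrite -E !inE Ea Eb => /orP[] /eqP->; left.
Qed.

(** Turns the port found by a local search back into a neighbour. *)
Lemma find_map_index (T : eqType) (P : pred T) (s : seq T) :
  uniq s -> has P s -> exists u, [/\ u \in s, P u & find P s = index u s].
Proof.
case: s => // x0 s us hs; exists (nth x0 (x0 :: s) (find P (x0 :: s))).
rewrite nth_find // index_uniq // -?has_find //.
by rewrite mem_nth // -has_find.
Qed.

(** * Short distances in the line graph *)

Section Lines.
Variable G : sgraph.
Implicit Types (u v w : G) (e f : {set G}).

Lemma edgesP e : reflect (exists u v, adj u v /\ e = [set u; v]) (e \in edges G).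
Proof.
apply: (iffP imsetP) => [[[u v]] /= | [u [v [uv ->]]]].
  by rewrite inE => uv ->; exists u, v.
by exists (u, v); rewrite ?inE.
Qed.

Lemma mem_edges u v : adj u v -> [set u; v] \in edges G.
Proof. by move=> uv; apply/edgesP; exists u, v. Qed.

Lemma in_edge e v : e \in edges G -> v \in e -> exists2 u, adj v u & e = [set v; u].
Proof.
case/edgesP=> a [b [ab ->]]; rewrite !inE => /orP[] /eqP->; first by exists b.
by exists a; rewrite 1?adj_sym 1?setUC.
Qed.

Lemma line_adj_share e f v : e \in edges G -> f \in edges G -> e != f ->
  v \in e -> v \in f -> line_adj e f.
Proof.
move=> eE fE ef ve vf; rewrite /line_adj eE fE ef /=.
by apply/set0Pn; exists v; rewrite inE ve.
Qed.

Lemma is_dist_share e f v : e \in edges G -> f \in edges G -> e != f ->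
  v \in e -> v \in f -> is_dist (@line_adj G) e f 1.
Proof.
move=> eE fE ef ve vf; split.
  by exists [:: f]; rewrite /= (line_adj_share _ _ _ ve).
by case=> [|g p] //= _ E; rewrite E eqxx in ef.
Qed.

(** Some of the three edges may coincide, and [e] and [g] may meet, so the distance is 0, 1 or 2
    according to the case. *)
Lemma is_dist_share2 e f g v w :
  e \in edges G -> f \in edges G -> g \in edges G ->
  v \in e -> v \in f -> w \in f -> w \in g ->
  exists2 d, is_dist (@line_adj G) e g d & d <= 2.
Proof.
move=> eE fE gE ve vf wf wg.
have [<-|eg] := eqVneq e g; first by exists 0 => //; split; first by exists [::].
have [le|nle] := boolP (line_adj e g).
  exists 1 => //; split; first by exists [:: g]; rewrite /= le.
  by case=> //= _ E; rewrite E eqxx in eg.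
have [ef|ef] := eqVneq e f.
  by subst f; case/negP: nle; apply: (line_adj_share (v := w)).
have [fg|fg] := eqVneq f g.
  by subst g; case/negP: nle; apply: (line_adj_share (v := v)).
exists 2 => //; split.
  exists [:: f; g]; rewrite /= (line_adj_share (v := v)) //.
  by rewrite (line_adj_share (v := w)).
case=> [|x [|y p]] //=; first by move=> _ E; rewrite E eqxx in eg.
by rewrite andbT => lx E; rewrite -E lx in nle.
Qed.
End Lines.

(** * The algorithm *)

Record nstate := NState {
  time : nat;
  lay : option nat;
  par : nat;
  mate : option nat
}.

Section Algorithm.
Variable b : nat.

(* The rounds before [b] build the layers. The rounds [b + 2 * i] and
   [b + 2 * i + 1] carry the proposals of layer [b - i] and the answers of layer
   [b - i - 1]; in round [3 * b] layer 0 proposes to itself along the edges of R,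
   and these proposals need no answer, being mutual. *)
Definition speaks (s : nstate) (p : nat) : bool :=
  if time s < b then lay s == Some (time s)
  else let i := time s - b in let d := b - i./2 in
    if odd i then (lay s == Some d.-1) && (mate s == Some p)
    else [&& lay s == Some d, mate s == None & p == par s].

(** From round [b] on, one rule serves both a parent accepting a proposal and a child receiving the
    answer; among several proposals the lowest port wins. *)
Definition listen (s : nstate) (msgs : seq (option bitseq)) : nstate :=
  let heard := has isSome msgs in
  let p := find isSome msgs in
  let joins := [&& time s < b, lay s == None & heard] in
  NState (time s).+1 (if joins then Some (time s).+1 else lay s)
    (if joins then p else par s)
    (if [&& b <= time s, mate s == None & heard] then Some p else mate s).

(** In layer 0 the initial [par] is the port of the edge of [R]. Elsewhere it is the degree, which
    is no port, and it is overwritten if the node joins a layer. *)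
Definition alg : algorithm :=
  Algorithm
    (fun _ r => NState 0 (if true \in r then Some 0 else None) (index true r) None)
    (fun s p => if speaks s p then Some [::] else None)
    listen
    (fun s p => mate s == Some p).

(** * Executions in terms of nodes rather than ports *)

Variables (N : network) (R : {set {set N}}).
Hypothesis R_edges : R \subset edges N.
Hypothesis R_matching :
  forall e f (v : N), e \in R -> f \in R -> v \in e -> v \in f -> e = f.

Implicit Types (u v w : N) (t : nat).

Local Notation layer t v := (lay (run alg R t v)).
Definition says t u v := speaks (run alg R t u) (index v (nbrs u)).
Definition heard t v := has (fun u => says t u v) (nbrs v).
Definition port_heard t v := find (fun u => says t u v) (nbrs v).
Definition matched t v := mate (run alg R t v) != None.
(** One-sided: this is the knowledge of [v]. Between a proposal and its answer only the accepting
    parent has it. *)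
Definition mated t v u :=
  adj v u && (mate (run alg R t v) == Some (index u (nbrs v))).
Definition child t v u := adj v u && (par (run alg R t v) == index u (nbrs v)).

Lemma index_nbrs_inj v u w :
  adj v u -> adj v w -> index u (nbrs v) = index w (nbrs v) -> u = w.
Proof.
rewrite -!mem_nbrs; exact: index_inj.
Qed.

Lemma mated_inj t v u w : mated t v u -> mated t v w -> u = w.
Proof.
move=> /andP[vu /eqP E] /andP[vw /eqP]; rewrite E => -[].
exact: index_nbrs_inj.
Qed.

Lemma child_inj t v u w : child t v u -> child t v w -> u = w.
Proof.
move=> /andP[vu /eqP E] /andP[vw /eqP]; rewrite E.
exact: index_nbrs_inj.
Qed.

Lemma heardP t v : reflect (exists2 u, adj v u & says t u v) (heard t v).
Proof.
apply: (iffP hasP) => -[u]; first by rewrite mem_nbrs; exists u.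
by move=> vu su; exists u; rewrite ?mem_nbrs.
Qed.

Lemma port_heardP t v : heard t v ->
  exists u, [/\ adj v u, says t u v & port_heard t v = index u (nbrs v)].
Proof.
case/(find_map_index (nbrs_uniq v)) => u [].
by rewrite mem_nbrs => vu su E; exists u.
Qed.

Lemma time_run t v : time (run alg R t v) = t.
Proof. by elim: t => //= t ->. Qed.

Lemma runS t v : run alg R t.+1 v =
  let joins := [&& t < b, layer t v == None & heard t v] in
  NState t.+1 (if joins then Some t.+1 else layer t v)
    (if joins then port_heard t v else par (run alg R t v))
    (if [&& b <= t, mate (run alg R t v) == None & heard t v]
     then Some (port_heard t v) else mate (run alg R t v)).
Proof.
rewrite /= /listen time_run.
have E : isSome \o (fun u => message (run alg R t) u v) =1 (fun u => says t u v).
  by move=> u /=; rewrite /message /= /says; case: (speaks _ _).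
by rewrite has_map find_map /heard /port_heard (eq_has E) (eq_find E).
Qed.

Lemma says_layer t u v : t < b -> says t u v = (layer t u == Some t).
Proof. by rewrite /says /speaks time_run => ->. Qed.

Lemma says_propose i u v : adj v u -> says (b + i.*2) u v =
  [&& layer (b + i.*2) u == Some (b - i), ~~ matched (b + i.*2) u
    & child (b + i.*2) u v].
Proof.
rewrite adj_sym /child /matched negbK => -> /=.
rewrite /says /speaks time_run ltnNge leq_addr /= addKn odd_double doubleK.
by rewrite [index _ _ == _]eq_sym.
Qed.

Lemma says_answer i u v : adj v u -> says (b + i.*2).+1 u v =
  (layer (b + i.*2).+1 u == Some (b - i).-1) && mated (b + i.*2).+1 u v.
Proof.
rewrite adj_sym /mated => -> /=.
rewrite /says /speaks time_run ltnNge leqW ?leq_addr //= -addnS addKn /=.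
by rewrite odd_double /= uphalf_double.
Qed.

Lemma layer_keep t v d : layer t v = Some d -> layer t.+1 v = Some d.
Proof. by rewrite runS /= => ->; rewrite andbF. Qed.

Lemma par_keep t v d : layer t v = Some d ->
  par (run alg R t.+1 v) = par (run alg R t v).
Proof. by rewrite runS /= => ->; rewrite andbF. Qed.

Lemma child_keep t v u d : layer t v = Some d -> child t.+1 v u = child t v u.
Proof. by move=> vd; rewrite /child (par_keep vd). Qed.

Lemma mate_keep t v : matched t v ->
  mate (run alg R t.+1 v) = mate (run alg R t v).
Proof. by rewrite runS /matched /=; case: (mate _); rewrite //= andbF. Qed.

Lemma matched_keep t v : matched t v -> matched t.+1 v.
Proof. by move=> m; rewrite /matched mate_keep. Qed.

Lemma mated_matched t v u : mated t v u -> matched t v.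
Proof. by case/andP=> _ /eqP; rewrite /matched => ->. Qed.

Lemma mated_keep t v u : mated t v u -> mated t.+1 v u.
Proof. by move=> m; rewrite /mated mate_keep // (mated_matched m). Qed.

Lemma matched_hear t v : b <= t -> ~~ matched t v -> heard t v ->
  exists u, [/\ adj v u, says t u v & mated t.+1 v u].
Proof.
rewrite /matched negbK => bt um h.
have [u [vu su E]] := port_heardP h.
exists u; split=> //.
by rewrite /mated vu runS /= bt um h /= E.
Qed.

Lemma matched_new t v : b <= t -> ~~ matched t v -> matched t.+1 v -> heard t v.
Proof.
rewrite /matched negbK => bt um; rewrite runS /= bt um /=.
by case: ifP => //; rewrite (eqP um).
Qed.

Lemma unmatched_early t v : t <= b -> ~~ matched t v.
Proof.
elim: t => // t IH tb; have := IH (ltnW tb).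
by rewrite /matched runS /= [b <= t]leqNgt tb.
Qed.

(** * Layers and parents *)

Lemma layer0P v : layer 0 v = Some 0 ->
  exists u, [set v; u] \in R /\ child 0 v u.
Proof.
rewrite /child /=; case: ifP => //.
rewrite -has_pred1 has_map /index find_map => h _.
have [u [vu Ru E]] := find_map_index (nbrs_uniq v) h.
exists u; rewrite -mem_nbrs vu; split; last exact/eqP.
by move: Ru => /= /eqP.
Qed.

Lemma layer0_mem e v : e \in R -> v \in e -> layer 0 v = Some 0.
Proof.
move=> eR ve; have [u vu E] := in_edge (subsetP R_edges e eR) ve.
suff -> : layer 0 v = if true \in [seq [set v; u] \in R | u <- nbrs v]
  then Some 0 else None by rewrite ifT //; apply/mapP; exists u; rewrite ?mem_nbrs -?E.
by [].
Qed.

(** The truncated predecessor lets one statement cover layer 0 too. There the parent is the partner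
    in [R], and the relation is symmetric because [R] is a matching. *)
Lemma child_layer t v d : layer t v = Some d ->
  d <= minn t b /\ exists u, [/\ child t v u, layer t u = Some d.-1
                       & d = 0 -> child t u v].
Proof.
elim: t d => [|t IH] d.
  move=> vd; have d0 : d = 0 by move: vd => /=; case: ifP => // _ [].
  rewrite d0 in vd *; split=> //.
  have [u [uR vu]] := layer0P vd; exists u.
  have u0 : layer 0 u = Some 0 by apply: layer0_mem uR (set22 _ _).
  split=> // _; have [w [wR uw]] := layer0P u0.
  have := R_matching uR wR (set22 _ _) (set21 _ _).
  by case/set2_eq=> [[E]|[->]] //; move: vu; rewrite E /child adj_irr.
case vt: (layer t v) => [j|] vd.
  move: (layer_keep vt); rewrite vd => -[E]; rewrite {d}E in vd *.
  have [jm [u [vu ut uv]]] := IH _ vt; split.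
    by apply: leq_trans jm _; rewrite leq_min geq_minr (leq_trans (geq_minl _ _)).
  exists u; split; rewrite ?(child_keep _ vt) ?(layer_keep ut) //.
  by move=> j0; rewrite (child_keep _ ut) uv.
move: vd; rewrite runS /= vt /=; case: ifP => // /andP[tb h] [<-].
split; first by rewrite leq_min leqnn.
have [u [vu su E]] := port_heardP h; exists u; split=> //.
  by rewrite /child vu runS /= tb vt h /= E.
by apply: layer_keep; apply/eqP; rewrite -(says_layer _ v tb).
Qed.

(** Nodes of layer [d] speak in round [d], and a neighbour without a layer joins on hearing them. *)
Lemma layer_adj t u v d : t <= b -> adj v u -> layer t u = Some d -> d < t ->
  layer t v != None.
Proof.
elim: t d => // t IH d tb vu ud; rewrite ltnS leq_eqVlt => dt.
case vt: (layer t v) => [j|]; first by rewrite (layer_keep vt).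
case ut: (layer t u) => [j|]; last first.
  by move: ud dt; rewrite runS /= ut /=; case: ifP => // _ [<-]; lia.
have jd : j = d by move: (layer_keep ut); rewrite ud => -[].
rewrite {j}jd in ut; case/orP: dt => [/eqP dt | dt]; last first.
  by have := IH d (ltnW tb) vu ut dt; rewrite vt.
have h : heard t v by apply/heardP; exists u; rewrite // says_layer // ut dt.
by rewrite runS /= tb vt h.
Qed.

Lemma layerS_adj t u v : t < b -> adj v u -> layer t u != None ->
  layer t.+1 v != None.
Proof.
move=> tb vu; case ut: (layer t u) => [d|] // _.
apply: (layer_adj tb vu (layer_keep ut)).
by have [] := child_layer ut; rewrite ltnS leq_min => /andP[].
Qed.

Lemma layerS_some t v : layer t v != None -> layer t.+1 v != None.
Proof. by case E: (layer t v) => [d|] // _; rewrite (layer_keep E). Qed.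

(** Each step in the line graph costs one round: a node shared with the next edge has a layer by
    induction, and [v] is that node or a neighbour of it. *)
Lemma layer_path t e p v : path (@line_adj N) e p -> last e p \in R ->
  size p <= t -> t <= b -> v \in e -> layer t v != None.
Proof.
elim: t e p v => [|t IH] e p v; case: p => [|f p].
- by move=> _ eR _ _ ve; rewrite (layer0_mem eR ve).
- by [].
- by move=> _ eR _ tb ve; apply/layerS_some/(IH e [::]) => //; apply: ltnW.
rewrite [path _ _ _]/= => /andP[/and4P[eE fE _ /set0Pn[w /setIP[we wf]]] fp] lR pt tb ve.
have wt := IH f p w fp lR pt (ltnW tb) wf.
have [u vu E] := in_edge eE ve.
move: we; rewrite E !inE => /orP[] /eqP Ew; rewrite Ew in wt.
  exact: layerS_some.
exact: layerS_adj wt.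
Qed.

Lemma layer_late t v : b <= t -> layer t.+1 v = layer t v.
Proof. by move=> bt; rewrite runS /= ltnNge bt. Qed.

Lemma layer_after i v : layer (b + i) v = layer b v.
Proof. by elim: i => [|i IH]; rewrite ?addn0 // addnS layer_late ?leq_addr. Qed.

(** * Proposals, answers and the invariant of the matching *)

Lemma proposeP i u v : adj v u -> says (b + i.*2) u v ->
  [/\ layer (b + i.*2) u = Some (b - i), layer (b + i.*2) v = Some (b - i).-1,
      ~~ matched (b + i.*2) u, child (b + i.*2) u v
    & b - i = 0 -> child (b + i.*2) v u].
Proof.
move=> vu; rewrite says_propose // => /and3P[/eqP ul um uv].
have [_ [w [uw wl wu]]] := child_layer ul.
by rewrite (child_inj uv uw); split=> //; rewrite -(child_inj uv uw).
Qed.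

Definition covered t v := matched t v \/ exists2 u, adj v u & matched t u.
Definition mate_sym t :=
  forall v, matched t v -> exists u, mated t v u && mated t u v.

(** The state just before layer [b - i] proposes. That layer is left unconstrained: some of its
    nodes may have accepted a proposal from above, the others are about to propose. *)
Definition matching_above i :=
  let t := b + i.*2 in
  [/\ mate_sym t,
      forall v j, layer t v = Some j -> j < b - i -> ~~ matched t v
    & forall v j, layer t v = Some j -> b - i < j -> covered t v].

Lemma covered_keep t v : covered t v -> covered t.+1 v.
Proof.
case=> [m|[u vu m]]; first by left; apply: matched_keep.
by right; exists u => //; apply: matched_keep.
Qed.

(** If [v] is unmatched it proposes, and its parent is either matched already or accepts somebody
    now. *)
Lemma propose_covered i v : layer (b + i.*2) v = Some (b - i) ->
  covered (b + i.*2).+1 v.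
Proof.
set t := b + i.*2 => vl.
have [m|um] := boolP (matched t v); first by left; apply: matched_keep.
have [_ [u [vu ul _]]] := child_layer vl.
have auv : adj u v by rewrite adj_sym; case/andP: vu.
right; exists u; first by rewrite adj_sym.
have [m|umu] := boolP (matched t u); first exact: matched_keep.
have h : heard t u.
  by apply/heardP; exists v; rewrite // says_propose // vl eqxx um vu.
by have [w [_ _ /mated_matched]] := matched_hear (leq_addr _ _) umu h.
Qed.

Lemma matching_above0 : matching_above 0.
Proof.
rewrite /matching_above double0 addn0 subn0.
have um v := unmatched_early v (leqnn b).
split=> [v m|v j _ _|v j vl jb]; first by move: (um v); rewrite m.
  exact: um.
by have [] := child_layer vl; rewrite minnn leqNgt jb.
Qed.

Lemma matching_aboveS i : i < b -> matching_above i -> matching_above i.+1.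
Proof.
move=> ib []; rewrite /matching_above; set t := b + i.*2 => sym low dom.
have -> : b + i.+1.*2 = t.+2 by rewrite /t; lia.
have bt : b <= t by rewrite leq_addr.
have bt1 : b <= t.+1 by rewrite leqW.
have dE : b - i = (b - i.+1).+1 by lia.
(* By [low] this layer was unmatched, so every mate held there now is a proposer accepted in this
   round; no answer can go to an older mate. *)
have new v : matched t.+1 v -> layer t v = Some (b - i.+1) ->
    exists u, [/\ mated t.+1 v u, layer t u = Some (b - i),
                  ~~ matched t u & child t u v].
  move=> m vl; have um := low v _ vl; rewrite dE leqnn in um.
  have [u [vu su vu1]] := matched_hear bt (um isT) (matched_new bt (um isT) m).
  by have [ul _ umu uv _] := proposeP vu su; exists u.
have answer u v : adj v u -> says t.+1 u v ->
    [/\ mated t.+1 u v, layer t v = Some (b - i), ~~ matched t v & child t v u].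
  move=> vu; rewrite says_answer // layer_late // dE /= => /andP[/eqP ul uv].
  have [w [uw wl um wu]] := new _ (mated_matched uv) ul.
  by rewrite (mated_inj uv uw) -dE.
have propose_low v : ~~ matched t v -> matched t.+1 v ->
    layer t v = Some (b - i.+1).
  move=> um m; have /heardP[u vu su] := matched_new bt um m.
  by have [_ ->] := proposeP vu su; rewrite dE.
split.
- move=> v m2; have [m1|um1] := boolP (matched t.+1 v); last first.
    have [u [vu su vu2]] := matched_hear bt1 um1 (matched_new bt1 um1 m2).
    have [uv _ _ _] := answer _ _ vu su.
    by exists u; rewrite vu2 mated_keep.
  have [m|um] := boolP (matched t v).
    by have [u /andP[vu uv]] := sym v m; exists u; rewrite !mated_keep.
  have vl := propose_low v um m1.
  have [u [vu ul umu uv]] := new v m1 vl; exists u; rewrite mated_keep //=.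
  (* The proposer [u] is still free, since proposals match only the layer below it. Answers reach it
     only from its parent, so it becomes mated to [v]. *)
  have um1 : ~~ matched t.+1 u.
    by apply/negP=> /(propose_low u umu); rewrite ul dE => -[]; lia.
  have h : heard t.+1 u.
    apply/heardP; exists v; first by case/andP: uv.
    by rewrite says_answer ?layer_late ?vl ?dE ?eqxx //=; case/andP: uv.
  have [w [uw sw uw2]] := matched_hear bt1 um1 h.
  by have [_ _ _ cw] := answer _ _ uw sw; rewrite (child_inj uv cw).
- move=> v j; rewrite !layer_late // => vl jd.
  have um := low v j vl; rewrite dE (ltnW _) // in um.
  have um1 : ~~ matched t.+1 v.
    by apply/negP=> /(propose_low v (um isT)); rewrite vl => -[]; lia.
  apply/negP=> /(matched_new bt1 um1)/heardP[u vu su].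
  by have [_] := answer _ _ vu su; rewrite vl => -[]; lia.
move=> v j; rewrite !layer_late // => vl jd; apply: covered_keep.
have [E|jd'] := eqVneq j (b - i).
  by apply: propose_covered; rewrite vl E.
by apply/covered_keep/(dom v j) => //; lia.
Qed.

Lemma matching_above_all : matching_above b.
Proof.
suff: forall i, i <= b -> matching_above i by apply.
elim=> [_|i IH ib]; first exact: matching_above0.
by apply: matching_aboveS => //; apply/IH/ltnW.
Qed.

Local Notation T := (b * 3).+1.

Lemma final_matching :
  mate_sym T /\ forall v, layer b v != None -> covered T v.
Proof.
have := matching_above_all; rewrite /matching_above.
have -> : b * 3 = b + b.*2 by lia.
set t := b + b.*2; rewrite subnn => -[sym _ dom].
have bt : b <= t by rewrite leq_addr.
split=> v.
  move=> m1; have [m|um] := boolP (matched t v).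
    by have [u /andP[vu uv]] := sym v m; exists u; rewrite !mated_keep.
  have [u [vu su vu1]] := matched_hear bt um (matched_new bt um m1).
  have [ul vl umu uv] := proposeP vu su; rewrite subnn in ul vl * => /(_ erefl) cvu.
  exists u; rewrite vu1 /=.
  (* In the same round [v] proposes to [u], and whoever [u] picks is its partner in [R], that is,
     [v]. *)
  have h : heard t u.
    apply/heardP; exists v; first by rewrite adj_sym.
    by rewrite says_propose ?subnn ?vl ?um //= adj_sym.
  have [w [uw sw uw1]] := matched_hear bt umu h.
  have [_ _ _ _] := proposeP uw sw; rewrite subnn => /(_ erefl) cuw.
  by rewrite (child_inj uv cuw).
rewrite -(layer_after b.*2); case vl: (layer t v) => [[|j]|] // _.
  by apply: propose_covered; rewrite subnn.
by apply/covered_keep/(dom v j.+1).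
Qed.

(** * The output edge set is a 2-ruling matching *)

Definition result : {set {set N}} :=
  [set [set x.1; x.2] | x : N * N & mated T x.1 x.2].

Lemma mated_sym v u : mated T v u -> mated T u v.
Proof.
move=> vu; have [sym _] := final_matching.
have [w /andP[vw wv]] := sym v (mated_matched vu).
by rewrite (mated_inj vu vw).
Qed.

Lemma resultP e : reflect (exists v u, mated T v u /\ e = [set v; u]) (e \in result).
Proof.
apply: (iffP imsetP) => [[[v u]] /= | [v [u [vu ->]]]].
  by rewrite inE => vu ->; exists v, u.
by exists (v, u); rewrite ?inE.
Qed.

Lemma mem_result v u : ([set v; u] \in result) = mated T v u.
Proof.
apply/resultP/idP => [[a [c [ac /set2_eq[[-> ->] //|[-> ->]]]]]|vu].
  exact: mated_sym.
by exists v, u.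
Qed.

Lemma result_edges : result \subset edges N.
Proof.
by apply/subsetP=> e /resultP[v [u [/andP[vu _] ->]]]; apply: mem_edges.
Qed.

Lemma result_matching e f v :
  e \in result -> f \in result -> v \in e -> v \in f -> e = f.
Proof.
move=> eS fS ve vf.
have [u vu E] := in_edge (subsetP result_edges e eS) ve.
have [w vw F] := in_edge (subsetP result_edges f fS) vf.
by move: eS fS; rewrite E F !mem_result => mu /(mated_inj mu) ->.
Qed.

Hypothesis R_ruling : forall e, e \in edges N ->
  exists2 f, f \in R & exists2 d, is_dist (@line_adj N) e f d & d <= b.

Lemma result_ruling : ruling_edge_set 2 2 result.
Proof.
split; first exact: result_edges.
- move=> e f d eS fS ef [[p [ep lp <-]] _].
  (* A path of length one would make two distinct edges of the matching share a node. *)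
  case: p ep lp => [|g [|h p]] //=; first by move=> _ E; rewrite E eqxx in ef.
  rewrite andbT => /and4P[_ _ _ /set0Pn[w]]; rewrite inE => /andP[we wg] E.
  by rewrite E in wg; rewrite (result_matching eS fS we wg) eqxx in ef.
move=> e eE; have [v [u [vu E]]] := edgesP _ eE.
have ve : v \in e by rewrite E set21.
have [f fR [d [[p [ep lp <-]] _] pb]] := R_ruling eE.
have vl : layer b v != None by apply: (layer_path ep) ve => //; rewrite lp.
have [sym /(_ v vl) cov] := final_matching.
have res w : matched T w -> exists2 g, g \in result & w \in g.
  case/sym=> x /andP[wx _]; exists [set w; x]; last exact: set21.
  by rewrite mem_result.
have sE g := subsetP result_edges g.
(* The middle edge is [e] itself when [v] is matched, and the edge from [v] to [w] otherwise. *)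
case: cov => [/res[g gS vg]|[w vw /res[g gS wg]]]; exists g => //.
  exact: (@is_dist_share2 _ e e g v v) (sE _ gS) _ _ _ _.
by apply: (@is_dist_share2 _ e [set v; w] g v w) => //;
  rewrite ?mem_edges ?set21 ?set22 ?sE.
Qed.

Lemma alg_transforms : congest_transforms alg T 0 R (ruling_edge_set 2 2).
Proof.
split.
  by move=> t u v m _ _; rewrite /message /=; case: ifP => // _ [<-].
exists result; last exact: result_ruling.
split=> [|v u vu]; first exact: result_edges.
by rewrite mem_result /mated vu.
Qed.
End Algorithm.

(* C is the constant of O(beta); k and c are those of the O(log n)-bit
   identifiers and messages. *)
Theorem theorem4 :
  exists C : nat, forall k : nat, exists c : nat,
  forall beta : nat, 2 <= beta ->
  exists (A : algorithm) (T : nat), T <= C * beta /\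
    forall N : network, ids_within k N ->
    forall R : {set {set N}}, ruling_edge_set 2 beta R ->
      congest_transforms A T c R (ruling_edge_set 2 2).
Proof.
(* Layering takes [b] rounds, proposals and answers [2 * b], layer 0 one more; messages have size
   0. *)
exists 4 => k; exists 0 => b b2; exists (alg b), (b * 3).+1; split; first lia.
move=> N _ R [RE Rdist Rrul]; apply: alg_transforms => // e f v eR fR ve vf.
(* Distinct edges of [R] with a common node would be at distance 1. *)
apply/eqP/negPn/negP => ef; have RE' := subsetP RE.
by have := Rdist e f 1 eR fR ef (is_dist_share (RE' e eR) (RE' f fR) ef ve vf).
Qed.
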